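(* For all integers $m\ge1$ and $k\ge1$, $\Delta^*(m,k,1)=m+k-1$.
   Context: ''Measure'' means a finite Borel measure $\mu$ on $\mathbb{R}^d$ with $0<\mu(\mathbb{R}^d)<\infty$ such that every affine hyperplane has measure zero. Hyperplanes are affine; they are mutually orthogonal if their normal vectors are pairwise orthogonal. $\Delta^*(m,k,1)$ is the minimal dimension $d$ such that for any $m$ measures in $\mathbb{R}^d$ there exist $k$ mutually orthogonal hyperplanes each of which bisects every one of the $m$ measures (i.e. each closed half-space bounded by the hyperplane has measure $\mu(\mathbb{R}^d)/2$). *)

(* Defs.v *)
From HB Require Import structures.
From mathcomp Require Import all_boot all_order all_algebra.
From mathcomp Require Import all_classical all_reals all_analysis.
Set Implicit Arguments.
Unset Strict Implicit.
Unset Printing Implicit Defensive.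
Import Order.TTheory GRing.Theory Num.Theory.
Import numFieldNormedType.Exports.
Local Open Scope classical_set_scope.
Local Open Scope ring_scope.

Section EuclideanSpace.
Variables (R : realType) (d : nat).

(* R^d with the sigma-algebra generated by its open sets; the topology on
   'rV[R]_d is the library's one (sup norm), i.e. the usual topology of R^d. *)
Definition borelRd := g_sigma_algebraType (@open 'rV[R]_d).

Definition dotp (u v : 'rV[R]_d) : R := \sum_(i < d) u ord0 i * v ord0 i.

(* These sets are meant for u != 0, u being the normal vector. *)
Definition hyperplane (u : 'rV[R]_d) (c : R) : set borelRd :=
  [set x | dotp u x = c].
Definition lower_halfspace (u : 'rV[R]_d) (c : R) : set borelRd :=
  [set x | dotp u x <= c].
Definition upper_halfspace (u : 'rV[R]_d) (c : R) : set borelRd :=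
  [set x | c <= dotp u x].

Definition admissible (mu : {measure set borelRd -> \bar R}) : Prop :=
  (0 < mu setT < +oo)%E /\
  forall (u : 'rV[R]_d) (c : R), u != 0 -> mu (hyperplane u c) = 0%E.

Definition bisects (u : 'rV[R]_d) (c : R)
    (mu : {measure set borelRd -> \bar R}) : Prop :=
  mu (lower_halfspace u c) = ((2^-1)%:E * mu setT)%E /\
  mu (upper_halfspace u c) = ((2^-1)%:E * mu setT)%E.

(* The i-th hyperplane has normal vector u i and equation dotp (u i) x = c i. *)
Definition orthogonal_bisection (m k : nat) : Prop :=
  forall mu : 'I_m -> {measure set borelRd -> \bar R},
    (forall j, admissible (mu j)) ->
    exists (u : 'I_k -> 'rV[R]_d) (c : 'I_k -> R),
      [/\ forall i, u i != 0,
          forall i i', i != i' -> dotp (u i) (u i') = 0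
        & forall i j, bisects (u i) (c i) (mu j)].

End EuclideanSpace.

(* The value of Delta^*(m, k, 1) is d.  It is a relation rather than a function
   so that no default value is needed when no dimension qualifies. *)
Definition is_Delta_star1 (R : realType) (m k d : nat) : Prop :=
  orthogonal_bisection R d m k /\
  forall d' : nat, orthogonal_bisection R d' m k -> (d <= d')%N.

(* Main.v *)
Require Import Defs.
From mathcomp Require Import all_boot all_order all_algebra.
From mathcomp Require Import all_classical all_reals all_analysis.
From mathcomp Require Import ring lra zify.
Set Implicit Arguments.
Unset Strict Implicit.
Unset Printing Implicit Defensive.
Import Order.TTheory GRing.Theory Num.Theory.
Import numFieldNormedType.Exports.

(**
Lower bound on the dimension: let mu_p be the sum of the images of Lebesgue
measure on [0, 1] under t |-> p + gamma t and t |-> p - gamma t, where gamma is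
the moment curve.  It charges no hyperplane, and a hyperplane bisecting it goes
through its centre p.  Taking the centres 0, e_1, e_2, ..., the normals of
common bisecting hyperplanes lie in a coordinate subspace of dimension d - (m - 1),
so at most that many can be orthogonal.

Upper bound: choosing the normals one at a time, it suffices to find a bisecting
hyperplane with normal in a given m-dimensional subspace of R^d.  For v in
R^(m+1) \ {0} encoding a normal u and an offset c, let P_j be the open set where
mu_j (u.x < c) exceeds half of the total mass.  P_j and - P_j are disjoint, and
a point outside all the sets +-P_j is the required hyperplane.

Such a point exists by a Lyusternik-Shnirelmann argument: let eps_j be an odd
sign function which is true on P_j and false on - P_j.  On the fine iterated
barycentric subdivisions of the half of the boundary of the crosspolytope, the
cup product of the m cocycles delta eps_j takes the value 1, as one sees by
descending one dimension at a time.  Hence there are arbitrarily small simplices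
on which every eps_j changes sign; they accumulate at the required point.
*)

(** * Chains modulo 2 *)

Definition pairing (T : Type) (phi : T -> bool) (c : seq T) : bool :=
  \big[addb/false]_(s <- c) phi s.

(** Lists stand for formal sums modulo 2; testing against all cochains lets repeated simplices
    cancel without passing to a quotient. *)
Definition chain_eq (T : Type) (c c' : seq T) : Prop :=
  forall phi : T -> bool, pairing phi c = pairing phi c'.

Section Pairing.
Variable T : Type.
Implicit Types (phi psi : T -> bool) (c : seq T).

Lemma pairing_nil phi : pairing phi [::] = false.
Proof. by rewrite /pairing big_nil. Qed.

Lemma pairing_cons phi s c : pairing phi (s :: c) = phi s (+) pairing phi c.
Proof. by rewrite /pairing big_cons. Qed.

Lemma pairing_cat phi c c' :
  pairing phi (c ++ c') = pairing phi c (+) pairing phi c'.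
Proof. by rewrite /pairing big_cat. Qed.

Lemma eq_pairing phi psi c : phi =1 psi -> pairing phi c = pairing psi c.
Proof. by move=> e; apply: eq_bigr => s _; exact: e. Qed.

Lemma pairingD phi psi c :
  pairing (fun s => phi s (+) psi s) c = pairing phi c (+) pairing psi c.
Proof. by rewrite /pairing big_split. Qed.

Lemma pairingZ b phi c : pairing (fun s => b && phi s) c = b && pairing phi c.
Proof.
elim: c => [|s c IH]; first by rewrite !pairing_nil andbF.
by rewrite !pairing_cons IH -andb_addr.
Qed.

End Pairing.

Lemma pairing_map (T U : Type) (f : T -> U) (phi : U -> bool) (c : seq T) :
  pairing phi (map f c) = pairing (phi \o f) c.
Proof. by rewrite /pairing big_map. Qed.

Lemma pairing_flatten_map (T U : Type) (f : T -> seq U) (phi : U -> bool)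
    (c : seq T) :
  pairing phi (flatten (map f c)) = pairing (fun s => pairing phi (f s)) c.
Proof.
elim: c => [|s c IH] /=; first by rewrite !pairing_nil.
by rewrite pairing_cat pairing_cons IH.
Qed.

Lemma eq_in_pairing (T : eqType) (phi psi : T -> bool) (c : seq T) :
  {in c, phi =1 psi} -> pairing phi c = pairing psi c.
Proof.
move=> e; rewrite /pairing big_seq [RHS]big_seq.
by apply: eq_bigr => s /e.
Qed.

Lemma pairing_has (T : eqType) (phi : T -> bool) (c : seq T) :
  pairing phi c -> exists2 s, s \in c & phi s.
Proof.
move=> h; apply/hasP; apply: contraLR h => /hasPn h.
by rewrite /pairing big_seq big1 // => s /h /negbTE.
Qed.

(* A simplex is the list of its vertices and a chain modulo 2 is a list of
   simplices.  The boundary is augmented: the boundary of a vertex is [::]. *)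
Section Boundary.
Variable T : Type.
Implicit Types (s : seq T) (c : seq (seq T)).

Fixpoint bd s : seq (seq T) :=
  if s is x :: s' then s' :: map (cons x) (bd s') else [::].

Definition bdc c : seq (seq T) := flatten (map bd c).

Lemma pairing_bdc phi c : pairing phi (bdc c) = pairing (pairing phi \o bd) c.
Proof. exact: pairing_flatten_map. Qed.

Lemma pairing_bd_cons phi x s :
  pairing phi (bd (x :: s)) = phi s (+) pairing (phi \o cons x) (bd s).
Proof. by rewrite /= pairing_cons pairing_map. Qed.

Lemma bdc_cons x c :
  chain_eq (bdc (map (cons x) c)) (c ++ map (cons x) (bdc c)).
Proof.
move=> phi; rewrite pairing_bdc pairing_map pairing_cat pairing_map pairing_bdc.
rewrite -pairingD; apply: eq_pairing => s.
by rewrite /= pairing_cons pairing_map.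
Qed.

(** The boundary of [x :: s] is [s] plus the cone over [bd s]; in the second boundary [bd s] occurs
    twice and cancels, and induction removes the cone over [bd (bd s)]. *)
Lemma pairing_bd_bd phi s : pairing phi (bdc (bd s)) = false.
Proof.
rewrite pairing_bdc; elim: s phi => [|x s IH] phi /=.
  by rewrite pairing_nil.
rewrite pairing_cons pairing_map /=.
under [X in _ (+) X]eq_pairing do rewrite /= pairing_cons pairing_map.
by rewrite pairingD IH addbF addbb.
Qed.

End Boundary.

(** * Barycentric subdivision of chains *)

Section Subdivision.
Variables (T : Type) (b : seq T -> T).
Implicit Types (s : seq T) (c : seq (seq T)).

(** [n] stands for the number of vertices of the simplices of [c]: each one becomes the cone from
    its centre [b s] over its subdivided boundary, whose simplices have one vertex less. *)
Fixpoint sd n c : seq (seq T) :=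
  if n is n'.+1 then flatten [seq map (cons (b s)) (sd n' (bd s)) | s <- c]
  else c.

Lemma sdS n c :
  sd n.+1 c = flatten [seq map (cons (b s)) (sd n (bd s)) | s <- c].
Proof. by []. Qed.

Lemma pairing_sdS phi n c : pairing phi (sd n.+1 c) =
  pairing (fun s => pairing (phi \o cons (b s)) (sd n (bd s))) c.
Proof.
by rewrite sdS pairing_flatten_map; apply: eq_pairing => s; rewrite pairing_map.
Qed.

Lemma chain_eq_sd n c c' : chain_eq c c' -> chain_eq (sd n c) (sd n c').
Proof. by case: n => [//|n] e phi; rewrite !pairing_sdS e. Qed.

Lemma sd_cat n c c' : chain_eq (sd n (c ++ c')) (sd n c ++ sd n c').
Proof.
by case: n => [//|n] phi; rewrite pairing_cat !pairing_sdS pairing_cat.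
Qed.

Lemma sd_nil n : sd n [::] = [::].
Proof. by case: n. Qed.

Lemma pairing_sd_bdc phi n c :
  pairing phi (sd n (bdc c)) = pairing (fun s => pairing phi (sd n (bd s))) c.
Proof.
case: n => [|n]; first exact: pairing_bdc.
rewrite pairing_sdS pairing_bdc; apply: eq_pairing => s /=.
by rewrite pairing_flatten_map; apply: eq_pairing => t; rewrite pairing_map.
Qed.

End Subdivision.

Arguments sd : simpl never.

Section SubdivisionEq.
Variables (T : eqType) (b : seq T -> T).
Implicit Types (s : seq T) (c : seq (seq T)).

Lemma mem_bd_size s t n : size s = n.+1 -> t \in bd s -> size t = n.
Proof.
elim: s t n => [|x s IH] t n //= [sz]; rewrite inE => /predU1P[-> //|].
case/mapP => u us -> /=; case: n sz => [|n] sz; last by rewrite (IH u n).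
by move: us; rewrite (size0nil sz).
Qed.

Lemma mem_bd_sub s t : t \in bd s -> {subset t <= s}.
Proof.
elim: s t => [//|x s IH] t /=; rewrite inE => /predU1P[->|/mapP[u us ->]] y.
  by move=> ys; rewrite inE ys orbT.
by rewrite !inE => /predU1P[->|/(IH _ us) ->]; rewrite ?eqxx ?orbT.
Qed.

Lemma mem_sd n c t : t \in sd b n.+1 c ->
  exists2 s, s \in c & exists2 t', t' \in sd b n (bd s) & t = b s :: t'.
Proof.
by case/flattenP => u /mapP[s sc ->] /mapP[t' ht ->]; exists s => //; exists t'.
Qed.

Lemma size_sd n c : {in c, forall s, size s = n} ->
  {in sd b n c, forall t, size t = n}.
Proof.
elim: n c => [//|n IH] c hc t /mem_sd[s /hc sz [t' ht ->]] /=; congr _.+1.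
by apply: IH ht => u; apply: mem_bd_size.
Qed.

(* [bd] of the cone from [b s] over [sd (bd s)] is [sd (bd s)] plus the cone
   over [sd (bd (bd s))], which vanishes. *)
Lemma bdc_sd n c : {in c, forall s, size s = n.+1} ->
  chain_eq (bdc (sd b n.+1 c)) (sd b n (bdc c)).
Proof.
elim: n c => [|n IH] c hc phi; rewrite pairing_bdc pairing_sdS pairing_sd_bdc;
  apply: eq_in_pairing => s /hc sz.
  case: s sz => [|x []] //= _; rewrite !pairing_cons !pairing_nil /=.
  by rewrite pairing_cons pairing_nil !addbF.
set d := sd b n.+1 (bd s).
rewrite -[LHS](pairing_map (cons (b s)) (pairing phi \o @bd T)).
rewrite -pairing_bdc bdc_cons pairing_cat pairing_map.
have -> : chain_eq (bdc d) [::].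
  have h t : t \in bd s -> size t = n.+1 by apply: mem_bd_size.
  move=> psi; rewrite IH //.
  have e : chain_eq (bdc (bd s)) [::].
    by move=> xi; rewrite pairing_bd_bd pairing_nil.
  by rewrite (chain_eq_sd b n e psi) sd_nil.
by rewrite pairing_nil addbF.
Qed.

(** Traces a small simplex back to one starting simplex, so that a property specific to a facet of
    the crosspolytope can be followed through the subdivisions. *)
Lemma mem_iter_sd N n c t : t \in iter N (sd b n) c ->
  exists2 s, s \in c & t \in iter N (sd b n) [:: s].
Proof.
have sd1 k c' u : u \in sd b k c' -> exists2 s, s \in c' & u \in sd b k [:: s].
  case: k => [|k]; first by exists u; rewrite // inE.
  case/mem_sd => s sc [u' hu' ->]; exists s => //.
  by rewrite sdS /= cats0; apply: map_f.
have sd_sub k c1 c2 : {subset c1 <= c2} -> {subset sd b k c1 <= sd b k c2}.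
  move=> h u; case: k => [|k]; first exact: h.
  case/mem_sd => s /h sc [u' hu' ->].
  by rewrite sdS; apply/flatten_mapP; exists s => //; apply: map_f.
elim: N t => [|N IH] t; first by exists t; rewrite // inE.
rewrite iterS => /sd1 [u /IH [s sc hs] ht]; exists s => //.
by apply: sd_sub ht => v; rewrite inE => /eqP ->.
Qed.

Lemma size_iter_sd N n c : {in c, forall s, size s = n} ->
  {in iter N (sd b n) c, forall t, size t = n}.
Proof. by move=> hc; elim: N => [//|N IH] /=; exact: size_sd. Qed.

Lemma chain_eq_iter_sd N n c c' : chain_eq c c' ->
  chain_eq (iter N (sd b n) c) (iter N (sd b n) c').
Proof. by move=> e; elim: N => [//|N IH] /=; exact: chain_eq_sd. Qed.

Lemma bdc_iter_sd N n c : {in c, forall s, size s = n.+1} ->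
  chain_eq (bdc (iter N (sd b n.+1) c)) (iter N (sd b n) (bdc c)).
Proof.
move=> hc; elim: N => [//|N IH] phi /=.
rewrite bdc_sd; last exact: size_iter_sd.
exact: chain_eq_sd.
Qed.

Lemma iter_sd_cat N n c c' : chain_eq (iter N (sd b n) (c ++ c'))
  (iter N (sd b n) c ++ iter N (sd b n) c').
Proof.
elim: N => [//|N IH] phi /=.
by rewrite (chain_eq_sd b n IH) sd_cat.
Qed.

End SubdivisionEq.

(** * The crosspolytope and the antipodal map *)

Section Antipode.
Variables (T : eqType) (b : seq T -> T) (nu : T -> T).
Hypothesis bnu : forall s, b (map nu s) = nu (b s).

Lemma bd_map s : bd (map nu s) = map (map nu) (bd s).
Proof. by elim: s => [//|x s IH] /=; rewrite IH -!map_comp. Qed.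

Lemma sd_map n c : sd b n (map (map nu) c) = map (map nu) (sd b n c).
Proof.
elim: n c => [//|n IH] c; rewrite !sdS map_flatten -!map_comp.
congr flatten; apply: eq_map => s /=.
by rewrite bd_map IH bnu -!map_comp.
Qed.

Lemma iter_sd_map N n c :
  iter N (sd b n) (map (map nu) c) = map (map nu) (iter N (sd b n) c).
Proof. by elim: N => [//|N IH] /=; rewrite IH sd_map. Qed.

Lemma bdc_map c : bdc (map (map nu) c) = map (map nu) (bdc c).
Proof.
rewrite /bdc map_flatten -!map_comp; congr flatten.
by apply: eq_map => s /=; rewrite bd_map.
Qed.

Lemma chain_eq_map c c' : chain_eq c c' ->
  chain_eq (map (map nu) c) (map (map nu) c').
Proof. by move=> e phi; rewrite !pairing_map e. Qed.

(* [octa e i] is the boundary of the crosspolytope on [e 0], ..., [e i.-1] and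
   [hemi e i] one half of [octa e i.+1]. *)
Fixpoint octa (e : nat -> T) (i : nat) : seq (seq T) :=
  if i is i'.+1 then
    let h := map (cons (e i')) (octa e i') in h ++ map (map nu) h
  else [:: [::]].

Definition hemi e i := map (cons (e i)) (octa e i).

Lemma octaS e i : octa e i.+1 = hemi e i ++ map (map nu) (hemi e i).
Proof. by []. Qed.

Hypothesis nuK : involutive nu.

Lemma octa_map e i : chain_eq (map (map nu) (octa e i)) (octa e i).
Proof.
case: i => [//|i] phi; rewrite octaS map_cat !pairing_cat addbC.
congr (_ (+) _); rewrite -map_comp (@eq_map _ _ _ id) ?map_id // => s /=.
by rewrite -map_comp (@eq_map _ _ _ id) ?map_id // => x /=; rewrite nuK.
Qed.

(** By induction [octa e i] is a cycle, hence the boundary of the cone [hemi e i]. Being symmetric,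
    it also bounds the opposite cone, and the two copies cancel. *)
Lemma bdc_octa e i : chain_eq (bdc (octa e i)) [::].
Proof.
elim: i => [|i IH] phi; first by rewrite pairing_bdc pairing_cons !pairing_nil.
have bh : chain_eq (bdc (hemi e i)) (octa e i).
  by move=> psi; rewrite bdc_cons pairing_cat pairing_map IH pairing_nil addbF.
rewrite octaS /bdc map_cat flatten_cat -!/(bdc _) pairing_cat bdc_map.
by rewrite (chain_eq_map bh) bh octa_map addbb pairing_nil.
Qed.

Lemma bdc_hemi e i : chain_eq (bdc (hemi e i)) (octa e i).
Proof. 
move=> psi; rewrite bdc_cons pairing_cat pairing_map bdc_octa.
by rewrite pairing_nil addbF.
Qed.

Lemma size_octa e i : {in octa e i, forall s, size s = i}.
Proof.
elim: i => [|i IH] s; first by rewrite inE => /eqP ->.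
rewrite octaS mem_cat => /orP[/mapP[t /IH <- -> //]|].
by case/mapP => u /mapP[t /IH <- ->] ->; rewrite /= size_map.
Qed.

Lemma size_hemi e i : {in hemi e i, forall s, size s = i.+1}.
Proof. by move=> s /mapP[t /size_octa <- ->]. Qed.

End Antipode.

(** * Cup products of sign cochains *)

Section SignCochains.
Variables (T : eqType) (eps : nat -> T -> bool).

(* The cup product of the cocycles [delta (eps j)], [j < i]; values on lists of
   length other than [i.+1] are irrelevant. *)
Fixpoint cupw i (s : seq T) : bool :=
  if i is i'.+1 then
    if s is x :: s' then
      (eps i' x (+) eps i' (head x s')) && cupw i' s'
    else false
  else true.

(** The cup product of [eps i] with [cupw i]; it serves as a primitive of [cupw i.+1]. *)
Definition cupe i (s : seq T) : bool :=
  if s is x :: _ then eps i x && cupw i s else false.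

Lemma cupwS i x y s : cupw i.+1 [:: x, y & s] =
  (eps i x && cupw i (y :: s)) (+) cupe i (y :: s).
Proof. by rewrite /= andb_addl. Qed.

(** The first equation says that [cupw i] is a cocycle, the second that [cupe i] has coboundary
    [cupw i.+1]. For each [i] the second follows from the first, and both give the first for
    [i.+1]. *)
Lemma pairing_cupw_bd i x s : size s = i.+1 ->
  pairing (cupw i \o cons x) (bd s) = cupw i s /\
  pairing (cupe i) (bd (x :: s)) = cupw i.+1 (x :: s).
Proof.
have cupeP j y t : size t = j.+1 ->
    pairing (cupw j \o cons y) (bd t) = cupw j t ->
    pairing (cupe j) (bd (y :: t)) = cupw j.+1 (y :: t).
  case: t => // z t sz h; rewrite pairing_bd_cons.
  by rewrite cupwS addbC -h -pairingZ; congr (_ (+) _).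
elim: i x s => [|i IH] x s sz.
  suff h : pairing (cupw 0 \o cons x) (bd s) = cupw 0 s.
    by split => //; apply: cupeP.
  by case: s sz => [|y []] //= _; rewrite pairing_cons pairing_nil.
suff h : pairing (cupw i.+1 \o cons x) (bd s) = cupw i.+1 s.
  by split => //; apply: cupeP.
case: s sz => // y s [sz].
have [h1 h2] := IH y s sz.
rewrite -h2 -[RHS]/(false (+) _).
(* The cocycle [cupw i] vanishes on boundaries; the inserted zero supplies the other term of
   [cupwS]. *)
have -> : false = eps i x && pairing (cupw i) (bd (y :: s)).
  by rewrite pairing_bd_cons h1 addbb andbF.
rewrite -pairingZ -pairingD; apply: eq_in_pairing => t /mem_bd_size.
by move=> /(_ i.+1 (congr1 S sz)); case: t => // z t _; exact: cupwS.
Qed.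

Lemma pairing_cupe_bd i s : size s = i.+2 ->
  pairing (cupe i) (bd s) = cupw i.+1 s.
Proof. by case: s => // x s [/(pairing_cupw_bd x) []]. Qed.

(** Each factor of the cup product records a sign change along one edge of the simplex. *)
Lemma cupwP i s : size s = i.+1 -> cupw i s ->
  forall j, (j < i)%N -> exists x y, [/\ x \in s, y \in s & eps j x != eps j y].
Proof.
elim: i s => [//|i IH] [|x [|y s]] // [sz] /andP[exy ws] j.
rewrite ltnS leq_eqVlt => /predU1P[->|ji].
  exists x, y; split; rewrite ?inE ?eqxx ?orbT //.
  by move: exy => /=; case: (eps i x); case: (eps i y).
have [z [t [zs ts ezt]]] := IH (y :: s) (congr1 S sz) ws j ji.
by exists z, t; split => //; rewrite inE ?zs ?ts orbT.
Qed.

Variables (b : seq T -> T) (nu : T -> T) (good : pred T).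
Hypothesis bnu : forall s, b (map nu s) = nu (b s).
Hypothesis nuK : involutive nu.
Hypothesis epsN : forall i x, good x -> eps i (nu x) = ~~ eps i x.

Lemma cupw_map i s : all good s -> cupw i (map nu s) = cupw i s.
Proof.
elim: i s => [//|i IH] [//|x s] /= /andP[gx gs]; rewrite IH // epsN //.
congr (_ && _); case: s gs => [|y s] /=; first by rewrite epsN // !addbb.
by case/andP => gy _; rewrite epsN // addbN addNb negbK.
Qed.

(** [cupw i] agrees on the two antipodal simplices, while [eps i] is true at the first vertex of
    exactly one of them. *)
Lemma cupe_map i s : s != [::] -> all good s ->
  cupe i s (+) cupe i (map nu s) = cupw i s.
Proof.
case: s => // x s _ gs; rewrite /cupe -/(map nu (x :: s)) cupw_map //.
case/andP: gs => gx _; rewrite /= epsN //.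
by case: (eps i x); rewrite ?addbF.
Qed.

(* By the two coboundary formulas, the value of [cupw i] on a subdivided
   hemisphere does not depend on [i]. *)
Lemma pairing_cupw_hemi N e n :
  (forall i, (i <= n)%N ->
    {in iter N (sd b i.+1) (hemi nu e i), forall s, all good s}) ->
  pairing (cupw n) (iter N (sd b n.+1) (hemi nu e n)).
Proof.
elim: n => [|i IH] gh.
  set c := iter _ _ _.
  have sc : {in c, forall s, size s = 1}.
    by apply: size_iter_sd; exact: size_hemi.
  (* The boundary of a vertex is the empty simplex, so this counts vertices modulo 2 through the
     augmentation. *)
  have -> : pairing (cupw 0) c = pairing (pairing xpredT \o @bd T) c.
    apply: eq_in_pairing => s /sc; case: s => [|x []] //= _.
    by rewrite pairing_cons pairing_nil.
  rewrite -pairing_bdc bdc_iter_sd; last exact: size_hemi.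
  rewrite (chain_eq_iter_sd b N 0 (bdc_hemi nuK e 0)).
  by rewrite iter_fix //= pairing_cons pairing_nil.
set c := iter _ _ _.
have sc : {in c, forall s, size s = i.+2}.
  by apply: size_iter_sd; exact: size_hemi.
have -> : pairing (cupw i.+1) c = pairing (pairing (cupe i) \o @bd T) c.
  by apply: eq_in_pairing => s /sc sz /=; rewrite pairing_cupe_bd.
rewrite -pairing_bdc bdc_iter_sd; last exact: size_hemi.
(* The boundary consists of two antipodal subdivided hemispheres of one dimension less; adding up
   over antipodal simplices turns [cupe i] into [cupw i]. *)
rewrite (chain_eq_iter_sd b N i.+1 (bdc_hemi nuK e i.+1)) octaS.
rewrite iter_sd_cat pairing_cat iter_sd_map // pairing_map -pairingD.
rewrite (@eq_in_pairing _ _ (cupw i)).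
  by apply: IH => j /leqW; exact: gh.
move=> s hs; apply: cupe_map.
  by rewrite -size_eq0 (size_iter_sd (@size_hemi _ nu e i) hs).
exact: (gh i (leqnSn i)) hs.
Qed.

End SignCochains.

Local Open Scope classical_set_scope.
Local Open Scope ring_scope.

(** * Mesh of barycentric subdivisions *)

Lemma sumr_const_seq (V : zmodType) (T : Type) (s : seq T) (a : V) :
  \sum_(x <- s) a = a *+ size s.
Proof.
elim: s => [|x s IH]; first by rewrite big_nil.
by rewrite big_cons IH /= mulrS.
Qed.

Lemma mx_norm_leP (R : realType) (n : nat) (x : 'rV[R]_n) (r : R) : 0 <= r ->
  (`|x| <= r) <-> forall j, `|x ord0 j| <= r.
Proof.
move=> r0; rewrite /Num.norm /= mx_normrE; split => [h j|h].
  apply: le_trans h.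
  exact: (le_bigmax _ (fun ij => `|x ij.1 ij.2|) (ord0, j)).
by apply: bigmax_le => // -[i j] _ /=; rewrite (ord1 i); exact: h.
Qed.

Section Barycenter.
Variables (R : realType) (V : normedModType R).
Implicit Types (s : seq V) (c : seq (seq V)).

Definition bary s : V := (size s)%:R^-1 *: \sum_(x <- s) x.

Lemma baryN s : bary (map -%R s) = - bary s.
Proof. by rewrite /bary size_map big_map sumrN scalerN. Qed.

Lemma bary_sub s (v : V) : s != [::] ->
  bary s - v = (size s)%:R^-1 *: \sum_(x <- s) (x - v).
Proof.
rewrite -size_eq0 => s0; rewrite big_split /= sumr_const_seq scalerDr.
by rewrite -[X in _ = _ + _ *: X]scaler_nat scalerA mulVf ?scale1r ?pnatr_eq0.
Qed.

Lemma norm_bary_sub_le s (v : V) (r : R) : s != [::] ->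
  {in s, forall x, `|x - v| <= r} -> `|bary s - v| <= r.
Proof.
move=> s0 h; rewrite bary_sub // normrZ.
have n0 : 0 < (size s)%:R :> R by rewrite ltr0n lt0n size_eq0.
rewrite ger0_norm ?invr_ge0 ?(ltW n0) // ler_pdivrMl //.
apply: (le_trans (ler_norm_sum _ _ _)).
rewrite mulr_natl -sumr_const_seq big_seq [leRHS]big_seq.
exact: ler_sum.
Qed.

(** The summand at [v] itself vanishes, so only n - 1 of the n terms count, and (n - 1) / n is at
    most M / (M + 1). *)
Lemma norm_bary_sub_mem s (v : V) (r : R) (M : nat) : v \in s ->
  (size s <= M.+1)%N ->
  {in s, forall x, `|x - v| <= r} -> `|bary s - v| <= M%:R / M.+1%:R * r.
Proof.
move=> vs sM h; have s0 : s != [::] by case: s vs {h sM}.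
rewrite bary_sub // normrZ.
have n0 : 0 < (size s)%:R :> R by rewrite ltr0n lt0n size_eq0.
have r0 : 0 <= r by rewrite (le_trans _ (h v vs)).
rewrite ger0_norm ?invr_ge0 ?(ltW n0) // ler_pdivrMl //.
rewrite (big_rem v) //= subrr add0r.
apply: (le_trans (ler_norm_sum _ _ _)).
apply: (@le_trans _ _ (\sum_(x <- rem v s) r)).
  rewrite big_seq [leRHS]big_seq; apply: ler_sum => x /mem_rem; exact: h.
rewrite sumr_const_seq size_rem // -[leLHS]mulr_natl mulrA ler_wpM2r //.
rewrite mulrA ler_pdivlMr ?ltr0n // -!natrM ler_nat.
move: sM; case: (size s) => // k; rewrite ltnS /= => kM.
by rewrite mulnS mulSn mulnC leq_add2r.
Qed.

Lemma all_sd (C : pred V) n c :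
  (forall s, s != [::] -> all C s -> C (bary s)) ->
  {in c, forall s, size s = n /\ all C s} ->
  {in sd bary n c, forall t, all C t}.
Proof.
move=> hC; elim: n c => [|n IH] c hc t.
  by rewrite /sd => /hc [].
case/mem_sd => s /hc [sz Cs] [t' ht ->] /=.
rewrite hC ?IH -?size_eq0 ?sz //; apply: IH ht => u us.
split; first exact: mem_bd_size us.
by apply/allP => x /(mem_bd_sub us) /(allP Cs).
Qed.

Lemma all_iter_sd (C : pred V) N n c :
  (forall s, s != [::] -> all C s -> C (bary s)) ->
  {in c, forall s, size s = n /\ all C s} ->
  {in iter N (sd bary n) c, forall t, all C t}.
Proof.
move=> hC hc; elim: N => [|N IH]; first by move=> t /hc [].
apply: all_sd => // t ht; split; last exact: IH.
by apply: size_iter_sd ht => s /hc [].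
Qed.

(** For an edge at the barycentre, a ball around it containing the vertices of the proper faces is
    closed under barycentres, so it contains the subdivided boundary. The other edges lie in a
    subdivided face. Fixing [M] gives one factor for all dimensions. *)
Lemma mesh_sd (M n : nat) (D : R) c : (n <= M.+1)%N ->
  {in c, forall s, size s = n /\ {in s &, forall x y, `|x - y| <= D}} ->
  {in sd bary n c, forall t, {in t &, forall x y,
    `|x - y| <= M%:R / M.+1%:R * D}}.
Proof.
elim: n c => [|n IH] c nM hc t.
  by rewrite /sd => /hc [] /size0nil -> _ x.
case/mem_sd => s /hc [sz Ds] [t' ht ->].
have s0 : s != [::] by rewrite -size_eq0 sz.
have D0 : 0 <= D.
  case: s {ht sz} s0 Ds => // x s _ h.
  by apply: (le_trans _ (h x x _ _)); rewrite ?mem_head.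
have near_b y : y \in t' -> `|bary s - y| <= M%:R / M.+1%:R * D.
  move=> yt; rewrite distrC.
  have /allP /(_ _ yt) // :
    all (fun y => `|y - bary s| <= M%:R / M.+1%:R * D) t'.
  apply: all_sd ht => [u u0 /allP hu|u us]; first exact: norm_bary_sub_le.
  split; first exact: mem_bd_size us.
  apply/allP => v /(mem_bd_sub us) vs /=; rewrite distrC.
  by apply: norm_bary_sub_mem; rewrite // ?sz // => x xs; apply: Ds.
move=> x y; rewrite !inE => /predU1P[->|xt] /predU1P[->|yt].
- by rewrite subrr normr0 mulr_ge0 ?divr_ge0.
- exact: near_b.
- by rewrite distrC near_b.
apply: (IH (bd s) _ _ _ ht) => //; first exact: ltnW.
move=> u us; split; first exact: mem_bd_size us.
by move=> v w /(mem_bd_sub us) vs /(mem_bd_sub us) ws; apply: Ds.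
Qed.

Lemma mesh_iter_sd N (M n : nat) (D : R) c : (n <= M.+1)%N ->
  {in c, forall s, size s = n /\ {in s &, forall x y, `|x - y| <= D}} ->
  {in iter N (sd bary n) c, forall t, {in t &, forall x y,
    `|x - y| <= (M%:R / M.+1%:R) ^+ N * D}}.
Proof.
move=> nM hc; elim: N => [|N IH].
  by move=> t /hc [_ h] x y; rewrite expr0 mul1r; apply: h.
move=> t ht x y; rewrite exprS -mulrA; apply: (mesh_sd nM _ ht) => s hs.
split; last exact: IH.
by apply: size_iter_sd hs => u /hc [].
Qed.

End Barycenter.

(** * Facets of the crosspolytope *)

Section Crosspolytope.
Variables (R : realType) (m : nat).
Notation V := 'rV[R]_m.+1.

Definition unitv (i : nat) : V := delta_mx 0 (inord i).

(* Together with the bound on the norm, this keeps the points of the convex hull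
   of a facet of the crosspolytope, which spans [w x = 1], away from 0. *)
Definition facet (w : 'I_m.+1 -> R) : pred V :=
  fun x => (\sum_j w j * x ord0 j == 1) && (`|x| <= 1).

Lemma facet_bary w s : s != [::] -> all (facet w) s -> facet w (bary s).
Proof.
move=> s0 /allP hs; apply/andP; split; last first.
  rewrite -[bary s]subr0; apply: norm_bary_sub_le => // x /hs /andP[_].
  by rewrite subr0.
have n0 : (size s)%:R != 0 :> R by rewrite pnatr_eq0 size_eq0.
rewrite -(inj_eq (mulfI n0)) mulr1 mulr_sumr.
under eq_bigr => j _ do
  rewrite mxE summxE mulrCA [X in _ * X]mulrA mulfV // mul1r mulr_sumr.
rewrite exchange_big /= -[eqbRHS]sumr_const_seq big_seq [eqbRHS]big_seq.
by apply/eqP; apply: eq_bigr => x /hs /andP[/eqP].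
Qed.

(** [w] collects the signs of the facet. Earlier vertices have zero coordinate [i], so [w] can be
    set to 1 there when [unitv i] is added; the antipode negates [w]. *)
Lemma facet_octa i : (i <= m.+1)%N -> {in octa -%R unitv i, forall s,
  exists w, (forall j, `|w j| <= 1) /\ {in s, forall x, facet w x /\
    forall j : 'I_m.+1, (i <= j)%N -> x ord0 j = 0}}.
Proof.
elim: i => [|i IH] im s.
  by rewrite inE => /eqP ->; exists (fun=> 0); split => // j; rewrite normr0.
have hemiP t : t \in hemi -%R unitv i ->
  exists w, (forall j, `|w j| <= 1) /\ {in t, forall x, facet w x /\
    forall j : 'I_m.+1, (i.+1 <= j)%N -> x ord0 j = 0}.
  case/mapP => {t}t /(IH (ltnW im))[w [w1 hw]] ->.
  exists (fun j => if j == inord i then 1 else w j); split.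
    by move=> j; case: ifP => // _; rewrite normr1.
  move=> x; rewrite inE => /predU1P[->|xt].
    split; last first.
      move=> j ij; rewrite mxE eqxx -val_eqE /= inordK //.
      by rewrite gtn_eqF.
    apply/andP; split.
      rewrite (bigD1 (inord i)) //= eqxx mxE !eqxx mulr1 big1 ?addr0 // => j ji.
      by rewrite mxE (negbTE ji) mulr0.
    apply/mx_norm_leP => // j; rewrite mxE.
    by case: (_ && _); rewrite ?normr1 ?normr0.
  have [/andP[/eqP xw x1] x0] := hw x xt; split; last first.
    by move=> j /ltnW; apply: x0.
  rewrite /facet x1 andbT -xw; apply/eqP; apply: eq_bigr => j _.
  by case: eqP => // ->; rewrite x0 ?inordK // !mulr0.
rewrite octaS mem_cat => /orP[/hemiP //|/mapP[t /hemiP[w [w1 hw]] ->]].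
exists (fun j => - w j); split => [j|x /mapP[y /hw [/andP[yw y1] y0] ->]].
  by rewrite normrN.
split; last by move=> j /y0; rewrite mxE => ->; rewrite oppr0.
rewrite /facet normrN y1 andbT -(eqP yw); apply/eqP; apply: eq_bigr => j _.
by rewrite mxE mulrNN.
Qed.

End Crosspolytope.

(** * Antipodal open families *)

Lemma facet_norm_ge (R : realType) (m : nat) (w : 'I_m.+1 -> R)
    (x : 'rV[R]_m.+1) :
  (forall j, `|w j| <= 1) -> facet w x -> m.+1%:R^-1 <= `|x|.
Proof.
move=> w1 /andP[/eqP xw _]; rewrite -div1r ler_pdivrMr ?ltr0n //.
rewrite -[leLHS]xw; apply: (le_trans (ler_norm _)).
apply: (le_trans (ler_norm_sum _ _ _)).
apply: (@le_trans _ _ (\sum_(j < m.+1) `|x|)).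
  apply: ler_sum => j _; rewrite normrM -[leRHS]mul1r ler_pM //.
  by have /(mx_norm_leP x (normr_ge0 x)) := lexx `|x|.
by rewrite sumr_const card_ord mulr_natr.
Qed.

Lemma shell_compact (R : realType) (n : nat) (r : R) :
  compact [set x : 'rV[R]_n | r <= `|x| <= 1].
Proof.
apply: bounded_closed_compact.
  exists 1; split; first exact: num_real.
  by move=> M M1 x /= /andP[_ /le_trans]; apply; exact: ltW.
have -> : [set x : 'rV[R]_n | r <= `|x| <= 1] =
    [set x | r <= `|x|] `&` [set x | `|x| <= 1].
  by apply/seteqP; split => x /=; [move=> /andP[] | move=> [-> ->]].
apply: closedI.
  apply: (closed_comp _ (@closed_ge R r)) => x _; exact: norm_continuous.
by apply: (closed_comp _ (@closed_le R 1)) => x _; exact: norm_continuous.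
Qed.

Section Borsuk.
Variables (R : realType) (m : nat).
Notation V := 'rV[R]_m.+1.

(** A sign for the points in neither of two antipodal sets; it is odd because [x] and [- x] have the
    same nonzero coordinates. *)
Definition lex_sign (x : V) : bool :=
  if [pick j | x ord0 j != 0] is Some j then 0 < x ord0 j else false.

Lemma lex_signN x : x != 0 -> lex_sign (- x) = ~~ lex_sign x.
Proof.
move=> x0; rewrite /lex_sign.
rewrite (@eq_pick _ _ (fun j => x ord0 j != 0)); last first.
  by move=> j /=; rewrite mxE oppr_eq0.
case: pickP => [j xj|h].
  by rewrite mxE oppr_gt0 -leNgt le_eqVlt (negbTE xj).
case/eqP: x0; apply/matrixP => i j; rewrite (ord1 i) mxE.
by have /negbFE/eqP := h j.
Qed.

Variable P : 'I_m -> set V.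
Hypothesis P_open : forall i v, v != 0 -> P i v -> \forall w \near v, P i w.
Hypothesis P_disj : forall i v, v != 0 -> P i v -> ~ P i (- v).

(** The index is a natural number to match [eps]; if no ordinal has value [i], both tests fail and
    [lex_sign] keeps the function odd off 0. *)
Definition side (i : nat) (v : V) : bool :=
  if `[< exists2 j : 'I_m, j = i :> nat & P j v >] then true
  else if `[< exists2 j : 'I_m, j = i :> nat & P j (- v) >] then false
  else lex_sign v.

Lemma side_pos (i : 'I_m) v : P i v -> side i v.
Proof. by move=> h; rewrite /side; case: asboolP => // -[]; exists i. Qed.

Lemma side_neg (i : 'I_m) v : v != 0 -> P i (- v) -> side i v = false.
Proof.
move=> v0 h; rewrite /side; case: asboolP => [[j /val_inj -> hj]|_].
  by case: (P_disj v0 hj).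
by case: asboolP => // -[]; exists i.
Qed.

Lemma sideN i v : v != 0 -> side i (- v) = ~~ side i v.
Proof.
move=> v0; rewrite /side opprK.
case: asboolP => [[j ji hj]|hn]; case: asboolP => [[l li hl]|hp] //.
  have jl : j = l by apply: val_inj; rewrite /= ji.
  by subst l; case: (P_disj v0 hl).
exact: lex_signN.
Qed.

(** A simplex of the [N]-th subdivision with cup product 1. The factor 2 bounds the diameter of a
    facet, which lies in the unit ball. *)
Lemma fine_alternating_simplex (N : nat) : exists s : seq V,
  [/\ s != [::], {in s, forall x, m.+1%:R^-1 <= `|x| <= 1},
      {in s &, forall x y, `|x - y| <= (m%:R / m.+1%:R) ^+ N * 2}
    & forall i : 'I_m,
        exists x y, [/\ x \in s, y \in s & side i x != side i y]].
Proof.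
pose e := @unitv R m.
have hemi_facet i : (i <= m)%N -> {in hemi -%R e i, forall t,
    exists w, (forall j, `|w j| <= 1) /\ all (facet w) t}.
  move=> im t ht; have : t \in octa -%R e i.+1 by rewrite octaS mem_cat ht.
  move=> /(@facet_octa R m i.+1 im)[w [w1 h]]; exists w; split => //.
  by apply/allP => x /h [].
have sd_facet i : (i <= m)%N ->
    {in iter N (sd (@bary R V) i.+1) (hemi -%R e i), forall s,
    all (fun x => m.+1%:R^-1 <= `|x| <= 1) s}.
  move=> im s hs; have [t ht hst] := mem_iter_sd hs.
  have [w [w1 wt]] := hemi_facet i im t ht.
  have /allP sw : all (facet w) s.
    apply: (all_iter_sd (@facet_bary R m w)) hst => u; rewrite inE => /eqP ->.
    by split; first exact: (size_hemi ht).
  apply/allP => x /sw xw; rewrite (facet_norm_ge w1 xw).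
  by case/andP: xw.
have gh i : (i <= m)%N -> {in iter N (sd (@bary R V) i.+1) (hemi -%R e i),
    forall s, all (fun x => x != 0) s}.
  move=> im s /(sd_facet i im) /allP h; apply/allP => x /h /andP[x0 _].
  by rewrite -normr_gt0 (lt_le_trans _ x0) // invr_gt0 ltr0n.
have := pairing_cupw_hemi (@baryN R V) (@opprK V) sideN gh.
case/pairing_has => s hs ws.
have sz : size s = m.+1.
  by apply: size_iter_sd hs; exact: size_hemi.
exists s; split.
- by rewrite -size_eq0 sz.
- by apply/allP; exact: sd_facet hs.
- apply: (mesh_iter_sd (leqnn _) _ hs) => t ht.
  split; first exact: size_hemi ht.
  have [w [_ /allP wt]] := hemi_facet m (leqnn m) t ht.
  move=> x y /wt /andP[_ x1] /wt /andP[_ y1].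
  by apply: (le_trans (ler_normB _ _)); lra.
- by move=> i; exact: (cupwP sz ws (ltn_ord i)).
Qed.

(** Alternating simplices of vanishing diameter accumulate at a point [p], nonzero by the lower
    bound on norms. If [p] or [- p] were in [P i], one of these simplices would lie entirely on one
    side, making [side i] constant on it. *)
Lemma antipodal_open_cover : exists v : V,
  v != 0 /\ forall i, ~ P i v /\ ~ P i (- v).
Proof.
have [s hs] := choice fine_alternating_simplex.
pose x N : V := head 0 (s N).
have xs N : x N \in s N.
  have [+ _ _ _] := hs N; rewrite /x.
  by case: (s N) => // a l _; exact: mem_head.
have Kx : (x @ \oo) [set v : V | m.+1%:R^-1 <= `|v| <= 1].
  by exists 0 => // N _ /=; have [_ h _ _] := hs N; apply: h.
have [p [Kp px]] := @shell_compact R m.+1 m.+1%:R^-1 _ _ Kx.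
have p0 : p != 0.
  move: Kp => /= /andP[h _]; rewrite -normr_gt0 (lt_le_trans _ h) //.
(* The vertex [x N] is close to [p] for arbitrarily large [N], and the diameter of [s N] tends to
   0. *)
have meet (A : set V) : nbhs p A -> exists N, {in s N, forall y, A y}.
  move=> /nbhs_ballP [r /= r0 rA].
  pose rho : R := m%:R / m.+1%:R.
  have rho1 : `|rho| < 1.
    by rewrite ger0_norm ?divr_ge0 // ltr_pdivrMr ?ltr0n // mul1r ltr_nat.
  have h0 : \forall N \near \oo, rho ^+ N * 2 < r / 2.
    have : rho ^+ N * 2 @[N --> \oo] --> (0 * 2 : R).
      by apply: cvgM; [exact: cvg_expr|exact: cvg_cst].
    by rewrite mul0r => /cvgr_lt; apply; rewrite divr_gt0.
  case: h0 => N0 _ hN0.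
  have B : (x @ \oo) [set v | exists2 N, (N0 <= N)%N & v = x N].
    by exists N0 => // N /= hN; exists N.
  have r20 : 0 < r / 2 by rewrite divr_gt0.
  have [v [[N hN ->] pN]] := px _ _ B (nbhsx_ballx p (r / 2) r20).
  exists N => y ys; apply: rA; rewrite -ball_normE /=.
  have [_ _ mesh _] := hs N.
  have := mesh _ _ (xs N) ys; have := hN0 N hN.
  move: pN; rewrite -ball_normE /=.
  have := ler_distD (x N) p y; rewrite -/rho.
  by lra.
exists p; split => // i; split => Pi.
  have [N h] := meet _ (P_open p0 Pi).
  have [_ _ _ /(_ i) [a [b [/h as_ /h bs]]]] := hs N.
  by rewrite !side_pos.
have np0 : - p != 0 by rewrite oppr_eq0.
have : \forall w \near p, P i (- w).
  exact: (opp_continuous p) (P_open np0 Pi).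
move=> /meet [N h].
have [_ nz _ /(_ i) [a [b [as_ bs]]]] := hs N.
have nz' c : c \in s N -> c != 0.
  move=> /nz /andP[c0 _].
  by rewrite -normr_gt0 (lt_le_trans _ c0) // invr_gt0 ltr0n.
by rewrite !side_neg ?nz' //; [exact: h | exact: h].
Qed.


End Borsuk.

(** * Bisecting hyperplanes in a subspace *)

Section Halfspaces.
Variables (R : realType) (d : nat).
Implicit Types (u x : 'rV[R]_d) (c : R).

Lemma dotpDl u v x : dotp (u + v) x = dotp u x + dotp v x.
Proof.
by rewrite /dotp -big_split /=; apply: eq_bigr => i _; rewrite mxE mulrDl.
Qed.

Lemma dotpNl u x : dotp (- u) x = - dotp u x.
Proof. by rewrite /dotp -sumrN; apply: eq_bigr => i _; rewrite mxE mulNr. Qed.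

Lemma dotpC u x : dotp u x = dotp x u.
Proof. by apply: eq_bigr => i _; rewrite mulrC. Qed.

Lemma dotpDr x u v : dotp x (u + v) = dotp x u + dotp x v.
Proof. by rewrite dotpC dotpDl !(dotpC x). Qed.

Lemma dotpNr u x : dotp u (- x) = - dotp u x.
Proof. by rewrite dotpC dotpNl (dotpC u). Qed.

Lemma dot0p x : dotp 0 x = 0.
Proof. by rewrite /dotp big1 // => i _; rewrite mxE mul0r. Qed.

Lemma coord_norm_le u i : `|u ord0 i| <= `|u|.
Proof. by have /(mx_norm_leP u (normr_ge0 u)) := lexx `|u|. Qed.

Lemma dotp_norm_le u x : `|dotp u x| <= d%:R * `|u| * `|x|.
Proof.
apply: (le_trans (ler_norm_sum _ _ _)).
apply: (@le_trans _ _ (\sum_(i < d) `|u| * `|x|)).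
  by apply: ler_sum => i _; rewrite normrM ler_pM // coord_norm_le.
by rewrite sumr_const card_ord -mulrA mulr_natl.
Qed.

Lemma dotp_continuous u : continuous (dotp u).
Proof.
apply: (@continuous_big _ _ +%R _ _ _ _ _ (fun i x => u ord0 i * x ord0 i)).
  exact: add_continuous.
move=> i _ x; apply: continuousM; first exact: cst_continuous.
exact: coord_continuous.
Qed.

Lemma open_measurable_Rd (A : set 'rV[R]_d) : open A ->
  measurable (A : set (borelRd R d)).
Proof. exact: sub_sigma_algebra. Qed.

Definition open_halfspace u c : set (borelRd R d) := [set x | dotp u x < c].

Lemma measurable_open_halfspace u c : measurable (open_halfspace u c).
Proof.
apply: open_measurable_Rd; apply: (@open_comp _ _ (dotp u) [set y | y < c]).
  by move=> x _; exact: dotp_continuous.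
exact: open_lt.
Qed.

Lemma open_halfspaceN u c :
  open_halfspace (- u) (- c) = [set x | c < dotp u x].
Proof.
by apply/seteqP; split => x; rewrite /open_halfspace /= dotpNl ltrN2.
Qed.

Lemma lower_halfspaceE u c :
  lower_halfspace u c = ~` open_halfspace (- u) (- c).
Proof.
rewrite open_halfspaceN; apply/seteqP; split => x; rewrite /lower_halfspace /=.
  by rewrite leNgt => /negP.
by move/negP; rewrite -leNgt.
Qed.

Lemma upper_halfspaceE u c : upper_halfspace u c = ~` open_halfspace u c.
Proof.
apply/seteqP; split => x; rewrite /upper_halfspace /open_halfspace /=.
  by rewrite leNgt => /negP.
by move/negP; rewrite -leNgt.
Qed.

Lemma hyperplaneE u c :
  hyperplane u c = ~` (open_halfspace u c `|` open_halfspace (- u) (- c)).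
Proof.
rewrite open_halfspaceN; apply/seteqP; split => x.
  by rewrite /hyperplane /open_halfspace /= => ->; rewrite ltxx; case.
rewrite /hyperplane /open_halfspace /= => /not_orP[/negP + /negP].
by rewrite -!leNgt => h1 h2; apply/eqP; rewrite eq_le h1 h2.
Qed.

Lemma measurable_hyperplane u c : measurable (hyperplane u c).
Proof.
rewrite hyperplaneE; apply: measurableC; apply: measurableU;
  exact: measurable_open_halfspace.
Qed.

Variable mu : {measure set (borelRd R d) -> \bar R}.

Lemma measure_lower_halfspace u c : mu (lower_halfspace u c) =
  (mu (open_halfspace u c) + mu (hyperplane u c))%E.
Proof.
have -> : lower_halfspace u c = open_halfspace u c `|` hyperplane u c.
  apply/seteqP; split => x;
    rewrite /lower_halfspace /open_halfspace /hyperplane /=.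
    by rewrite le_eqVlt => /predU1P[->|->]; [right|left].
  by case=> [/ltW //|->].
rewrite measureU //; first exact: measurable_open_halfspace.
  exact: measurable_hyperplane.
apply/seteqP; split => x //; rewrite /open_halfspace /hyperplane /=.
by case=> + e; rewrite e ltxx.
Qed.

Lemma measure_halfspaces u c : mu setT =
  (mu (open_halfspace u c) + mu (hyperplane u c)
   + mu (open_halfspace (- u) (- c)))%E.
Proof.
rewrite -measure_lower_halfspace lower_halfspaceE addeC.
have mO := measurable_open_halfspace (- u) (- c).
by rewrite -(measureU mu mO (measurableC mO) (setICr _)) setUv.
Qed.

(** The half-space is the increasing union of the sets [F n] of points satisfying the inequality
    with margin (1 + |x|) / (n + 1). Some [F n] already has measure above [a], and a margin growing
    with |x| absorbs small changes of [u] and [c] uniformly. *)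
Lemma open_halfspace_lsc u c (a : \bar R) :
  (a < mu (open_halfspace u c))%E ->
  exists2 e : R, 0 < e & forall u' c', `|u' - u| < e -> `|c' - c| < e ->
    (a < mu (open_halfspace u' c'))%E.
Proof.
move=> ha; pose F n : set (borelRd R d) :=
  [set x : 'rV[R]_d | dotp u x + (1 + `|x|) / n.+1%:R < c].
have mF n : measurable (F n).
  apply: open_measurable_Rd.
  pose f (x : 'rV[R]_d) := dotp u x + (1 + `|x|) / n.+1%:R.
  apply: (@open_comp _ _ f [set y | y < c]); last exact: open_lt.
  move=> x _; apply: continuousD; first exact: dotp_continuous.
  apply: continuousM; last exact: cst_continuous.
  by apply: continuousD; [exact: cst_continuous|exact: norm_continuous].
have ndF : {homo F : n p / (n <= p)%N >-> (n <= p)%O}.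
  move=> n p np; apply/subsetPset => x; rewrite /F /=; apply: le_lt_trans.
  rewrite lerD2l ler_wpM2l ?addr_ge0 // lef_pV2 ?posrE ?ltr0n //.
  by rewrite ler_nat ltnS.
have UF : \bigcup_n F n = open_halfspace u c.
  apply/seteqP; split => x.
    case=> n _; rewrite /F /open_halfspace /=; apply: le_lt_trans.
    by rewrite lerDl divr_ge0 ?addr_ge0.
  rewrite /open_halfspace /= => xc.
  have e0 : 0 < c - dotp u x by rewrite subr_gt0.
  pose y := (1 + `|x|) / (c - dotp u x).
  exists (Num.truncn y) => //=; rewrite /F /= -ltrBrDl.
  rewrite ltr_pdivrMr ?ltr0n // mulrC -ltr_pdivrMr //.
  exact: truncnS_gt.
have := @nondecreasing_cvg_mu _ _ _ mu F mF _ ndF.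
rewrite UF => /(_ (measurable_open_halfspace u c)) /(_ [set y | (a < y)%E]) H.
have {H} [n _ /(_ n (leqnn n)) /= hn] : nbhs \oo (fun n => (a < mu (F n))%E).
  by apply: H; apply: open_nbhs_nbhs; split => //; exact: open_ereal_gt_ereal.
(* Changes of size e move the inequality by at most d e |x| + e, which is at most e (d + 1) (1 +
   |x|). *)
exists (n.+1%:R^-1 / (d%:R + 1)).
  by rewrite divr_gt0 ?invr_gt0 ?ltr0n // ltr_wpDl.
move=> u' c'; set e := _ / _ => hu hc; apply: (lt_le_trans hn).
apply: le_measure; rewrite ?inE //; first exact: measurable_open_halfspace.
move=> x; rewrite /F /open_halfspace /= => hx.
have := dotp_norm_le (u' - u) x.
rewrite dotpDl dotpNl => hd.
have d0 : 0 <= d%:R :> R by [].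
have e0 : 0 < e by exact: le_lt_trans hu.
have ee : n.+1%:R^-1 = e * (d%:R + 1) by rewrite /e divfK // gt_eqF // ltr_wpDl.
rewrite ee in hx.
have x0 := normr_ge0 x.
have h1 : d%:R * `|u' - u| * `|x| <= d%:R * e * `|x|.
  by rewrite ler_wpM2r // ler_wpM2l // ltW.
move: hd; rewrite ler_norml => /andP[_ hd].
move: hc; rewrite ltr_norml => /andP[hc _].
have : 0 <= e * d%:R by rewrite mulr_ge0 // ltW.
have : 0 <= e * `|x| by rewrite mulr_ge0 // ltW.
nra.
Qed.

End Halfspaces.

Lemma norm_mulmx_le (R : realType) (m d : nat) (B : 'M[R]_(m, d)) :
  exists2 K : R, 0 < K & forall w : 'rV[R]_m, `|w *m B| <= K * `|w|.
Proof.
exists (1 + \sum_i \sum_j `|B i j|) => [|w].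
  by rewrite ltr_pwDl // sumr_ge0 // => i _; rewrite sumr_ge0.
apply/mx_norm_leP.
  by rewrite mulr_ge0 // addr_ge0 // sumr_ge0 // => i _; rewrite sumr_ge0.
move=> j; rewrite mxE; apply: (le_trans (ler_norm_sum _ _ _)).
apply: (@le_trans _ _ (\sum_i `|B i j| * `|w|)).
  by apply: ler_sum => i _; rewrite normrM mulrC ler_wpM2l // coord_norm_le.
rewrite -mulr_suml ler_wpM2r // ler_wpDl // ler_sum // => i _.
by rewrite (bigD1 j) //= lerDl sumr_ge0.
Qed.

Section HamSandwich.
Variables (R : realType) (m d : nat) (B : 'M[R]_(m, d)).
Variable mu : 'I_m -> {measure set (borelRd R d) -> \bar R}.
Hypotheses (B_free : row_free B) (mu_adm : forall j, admissible (mu j)).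
Notation V := 'rV[R]_m.+1.

(** The first m coordinates of [v] are coefficients in the rows of [B] and the last is the offset,
    so [- v] describes the same hyperplane with its sides exchanged. *)
Definition normal (v : V) : 'rV[R]_d :=
  (\row_(i < m) v ord0 (widen_ord (leqnSn m) i)) *m B.
Definition offset (v : V) : R := v ord0 ord_max.

Definition cut v := open_halfspace (normal v) (offset v).

Lemma normalB v w : normal (v - w) = normal v - normal w.
Proof.
by rewrite /normal -mulmxBl; congr (_ *m _); apply/rowP => i; rewrite !mxE.
Qed.

Lemma normalN v : normal (- v) = - normal v.
Proof.
by rewrite /normal -mulNmx; congr (_ *m _); apply/rowP => i; rewrite !mxE.
Qed.

Lemma offsetN v : offset (- v) = - offset v.
Proof. by rewrite /offset mxE. Qed.

Lemma normal_offset_eq0 v : normal v = 0 -> offset v = 0 -> v = 0.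
Proof.
rewrite -(mul0mx _ B) => /(row_free_inj B_free) h o; apply/rowP => j.
rewrite mxE; case: (unliftP ord_max j) => [i ->|->] //.
move/rowP/(_ i): h; rewrite !mxE => <-; congr (v _ _).
by apply: val_inj; rewrite /= /bump leqNgt ltn_ord.
Qed.

(** A zero normal comes with a nonzero offset, and then the hyperplane is empty. *)
Lemma hyperplane_null j v : v != 0 ->
  mu j (hyperplane (normal v) (offset v)) = 0%E.
Proof.
move=> v0; have [u0|u0] := eqVneq (normal v) 0; last exact: (mu_adm j).2.
suff -> : hyperplane (normal v) (offset v) = set0 by rewrite measure0.
apply/seteqP; split => // x; rewrite /hyperplane /= u0 dot0p => o.
by case/eqP: v0; exact: normal_offset_eq0.
Qed.

Lemma cut_total j v : v != 0 ->
  mu j setT = (mu j (cut v) + mu j (cut (- v)))%E.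
Proof.
move=> v0; rewrite (measure_halfspaces (mu j) (normal v) (offset v)).
by rewrite hyperplane_null // adde0 /cut normalN offsetN.
Qed.

Lemma cut_near v (a : \bar R) j : (a < mu j (cut v))%E ->
  \forall w \near v, (a < mu j (cut w))%E.
Proof.
case/open_halfspace_lsc => e e0 he.
have [K K0 hK] := norm_mulmx_le B.
have r0 : 0 < e / (K + 1) by rewrite divr_gt0 // addr_gt0.
apply/nbhs_ballP; exists (e / (K + 1)) => // w.
rewrite -ball_normE /= distrC ltr_pdivlMr ?addr_gt0 // => hw.
have wv0 := normr_ge0 (w - v).
apply: he.
  rewrite -normalB; apply: (le_lt_trans (hK _)).
  set x := \row_i _; have : `|x| <= `|w - v|.
    by apply/mx_norm_leP => // i; rewrite mxE coord_norm_le.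
  by nra.
have := coord_norm_le (w - v) ord_max; rewrite /offset !mxE; nra.
Qed.

Lemma ham_sandwich (m0 : (0 < m)%N) : exists (u : 'rV[R]_d) (c : R),
  [/\ u != 0, (u <= B)%MS & forall j, bisects u c (mu j)].
Proof.
pose T j : R := fine (mu j setT).
have TE j : mu j setT = (T j)%:E.
  rewrite fineK //; have [/andP[T0 Too] _] := mu_adm j.
  by rewrite ge0_fin_numE // ltW.
have T0 j : 0 < T j by have [/andP[+ _] _] := mu_adm j; rewrite TE lte_fin.
pose g j v : R := fine (mu j (cut v)).
have gE j v : mu j (cut v) = (g j v)%:E.
  rewrite fineK // ge0_fin_numE //; apply: (@le_lt_trans _ _ (mu j setT)).
    by apply: le_measure; rewrite ?inE //; exact: measurable_open_halfspace.
  by rewrite TE ltry.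
have gT j v : v != 0 -> T j = g j v + g j (- v).
  by move=> v0; apply: EFin_inj; rewrite EFinD -!gE -TE; exact: cut_total.
have [v [v0 hv]] : exists v : V, v != 0 /\ forall j,
    ~ (T j / 2 < g j v) /\ ~ (T j / 2 < g j (- v)).
  apply: (@antipodal_open_cover R m (fun j => [set v | T j / 2 < g j v])).
  - move=> j v _ /= h.
    have : ((T j / 2)%:E < mu j (cut v))%E by rewrite gE lte_fin.
    by move/cut_near; apply: filterS => w; rewrite gE lte_fin.
  - by move=> j v v0 /= h1 h2; have := gT j v v0; lra.
(* Neither side exceeds half of the mass, and the two sides add up to all of it. *)
have gv j : g j v = T j / 2 /\ g j (- v) = T j / 2.
  have [/negP + /negP] := hv j; rewrite -!leNgt; have := gT j v v0; split; lra.
exists (normal v), (offset v); split; last first.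
- move=> j; split.
    rewrite measure_lower_halfspace hyperplane_null // adde0 -/(cut v).
    by rewrite gE TE -EFinM (gv j).1 mulrC.
  have -> : upper_halfspace (normal v) (offset v) =
      lower_halfspace (normal (- v)) (offset (- v)).
    by rewrite upper_halfspaceE lower_halfspaceE normalN offsetN !opprK.
  rewrite measure_lower_halfspace hyperplane_null ?oppr_eq0 // adde0.
  rewrite -/(cut (- v)).
  by rewrite gE TE -EFinM (gv j).2 mulrC.
- exact: submxMl.
(* With zero normal the cut would be everything or empty, hence would not halve the positive mass of
   the measure with index 0. *)
apply/eqP => u0.
pose j := Ordinal m0; have := T0 j; have [h _] := gv j.
have o0 : offset v != 0 by apply: contra_neq v0 => o; exact: normal_offset_eq0.
have : g j v = T j \/ g j v = 0.
  have [op|on] := ltP 0 (offset v); [left|right].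
    rewrite /T /g; have -> : cut v = setT; last by [].
    by apply/seteqP; split => // x _; rewrite /cut /open_halfspace /= u0 dot0p.
  rewrite /g; have -> : cut v = set0; last by rewrite measure0.
  apply/seteqP; split => // x; rewrite /cut /open_halfspace /= u0 dot0p.
  by rewrite ltNge on.
by case; lra.
Qed.

End HamSandwich.

(** * Choosing orthogonal normals one at a time *)

Lemma row_free_sub (F : fieldType) (n r m : nat) (K : 'M[F]_(r, n)) :
  (m <= \rank K)%N -> exists2 B : 'M[F]_(m, n), row_free B & (B <= K)%MS.
Proof.
move=> mK; exists ((pid_mx m : 'M[F]_(m, \rank K)) *m row_base K).
  rewrite /row_free mxrankMfree ?row_base_free // rank_pid_mx //.
by apply: (submx_trans (submxMl _ _)); rewrite eq_row_base.
Qed.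

Lemma orthogonal_bisection_exists (R : realType) (d m k : nat) : (0 < m)%N ->
  (m + k <= d.+1)%N -> orthogonal_bisection R d m k.
Proof.
move=> m0 mkd mu mu_adm.
(* Families indexed by natural numbers can be extended at [k] without casts between ordinals. *)
suff [u [c [u0 uu uc]]] : exists (u : nat -> 'rV[R]_d) (c : nat -> R),
    [/\ forall i, (i < k)%N -> u i != 0,
        forall i j, (j < i)%N -> (i < k)%N -> dotp (u i) (u j) = 0
      & forall i j, (i < k)%N -> bisects (u i) (c i) (mu j)].
  exists u, c; split => [i|i j|i j]; [exact: u0| |exact: uc].
  rewrite -val_eqE /= neq_ltn => /orP[h|h]; first by rewrite dotpC uu.
  exact: uu.
elim: k mkd => [|k IH] mkd; first by exists (fun=> 0), (fun=> 0).
have [u [c [u0 uu uc]]] := IH (leq_trans (leq_add (leqnn m) (leqnSn k)) mkd).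
pose A : 'M[R]_(k, d) := \matrix_(i < k) u i.
(* The orthogonal complement of the [k] chosen normals has dimension at least d - k, hence at least
   m. *)
have [B Bfree BA] : exists2 B : 'M[R]_(m, d), row_free B & (B <= kermx A^T)%MS.
  apply: row_free_sub; rewrite mxrank_ker mxrank_tr leq_subRL.
    rewrite (leq_trans (leq_add (rank_leq_row A) (leqnn m))) //.
    by rewrite addnC -ltnS -addnS.
  exact: rank_leq_col.
have [v [e [v0 vB ve]]] := ham_sandwich Bfree mu_adm m0.
have vA i : (i < k)%N -> dotp v (u i) = 0.
  move=> ik; have /sub_kermxP/rowP/(_ (Ordinal ik)) := submx_trans vB BA.
  by rewrite !mxE => <-; apply: eq_bigr => j _; rewrite !mxE.
exists (fun i => if i == k then v else u i).
exists (fun i => if i == k then e else c i).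
split => [i|i j|i j]; rewrite ltnS [(i <= k)%N]leq_eqVlt.
- by case: eqP => //= _; exact: u0.
- move=> ji /predU1P[ik|ik]; first by rewrite ik eqxx ltn_eqF -?ik // vA -?ik.
  by rewrite !ltn_eqF ?uu // (ltn_trans ji).
- by case: eqP => //= _; exact: uc.
Qed.

(** * Moment curve measures *)

Lemma finite_roots (R : idomainType) (p : {poly R}) : p != 0 ->
  finite_set [set t | root p t].
Proof.
move=> p0; apply: contrapT => /(infinite_set_fset (size p)) [B Bp].
rewrite leqNgt => /negP; apply; apply: max_poly_roots => //.
  by apply/allP => t tB; exact: Bp.
exact: finmap.fset_uniq.
Qed.

Lemma row_continuous (R : realType) (T : topologicalType) (d : nat)
    (f : T -> 'rV[R]_d) :
  (forall i, continuous (fun t => f t ord0 i)) -> continuous f.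
Proof.
move=> fc t A [P hP PA].
have : \forall s \near t, forall i, P ord0 i (f s ord0 i).
  by apply: filter_forall => i; apply: fc; exact: hP.
by apply: filterS => s hs; apply: PA => i j; rewrite (ord1 i).
Qed.

Section UnitInterval.
Variable R : realType.
Notation lam := (@lebesgue_measure R).
Notation I := (`[0, 1]%classic : set R).

Lemma lebesgue_unit : lam I = 1%E.
Proof. by rewrite lebesgue_measure_itv /= lte_fin ltr01 oppr0 adde0. Qed.

(* The sets [q <= e] and [- q <= e] cover the interval and overlap near 0. *)
Lemma lebesgue_sublevel_gt (q : R -> R) (e : R) : continuous q -> q 0 = 0 ->
  0 < e ->
  (1 < lam ([set t | (q t <= e)%R] `&` I)
       + lam ([set t | (- q t <= e)%R] `&` I))%E.
Proof.
move=> qc q0 e0.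
have mle (g : R -> R) : continuous g -> measurable ([set t | g t <= e] : set R).
  move=> gc; apply: measurable_realfun.closed_measurable.
  by apply: (closed_comp _ (@closed_le R e)) => t _; exact: gc.
have mI : measurable I by exact: measurable_itv.
set L := [set t | q t <= e]; set L' := [set t | - q t <= e].
have mL : measurable L by exact: mle.
have mL' : measurable L' by apply: mle => t; apply: continuousN; exact: qc.
have : \forall t \near (0 : R), - q t < e /\ q t < e.
  have h1 : \forall t \near (0 : R), q t < e.
    by apply: (qc 0 [set y | y < e]); apply: open_nbhs_nbhs; split;
       [exact: open_lt|rewrite /= q0].
  have h2 : \forall t \near (0 : R), - e < q t.
    by apply: (qc 0 [set y | - e < y]); apply: open_nbhs_nbhs; split;
       [exact: open_gt|rewrite /= q0 oppr_lt0].
  by near=> t; split; [rewrite ltrNl|]; near: t.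
move=> /nbhs_ballP [r /= r0 hr].
(* Small enough for [0, a] to lie both in the unit interval and in the ball where |q| < e. *)
pose a := Num.min (r / 2) 1.
have a0 : 0 < a by rewrite lt_min divr_gt0 // ltr01.
have ar : a < r by rewrite gt_min ltr_pdivrMr // ltr_pMr // ltr1n.
have a1 : a <= 1 by rewrite ge_min lexx orbT.
pose J := (`[0, a]%classic : set R).
have mJ : measurable J by exact: measurable_itv.
have lamJ : lam J = a%:E.
  by rewrite lebesgue_measure_itv /= lte_fin a0 oppr0 adde0.
have JL t : J t -> L t /\ L' t.
  rewrite /J /= in_itv /= => /andP[t0 ta].
  have [|h1 h2] := hr t; last by split; exact: ltW.
  by rewrite -ball_normE /= sub0r normrN ger0_norm // (le_lt_trans ta).
have mIL : measurable (I `\` L) by exact: measurableD.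
have split1 : (lam (L `&` I) + lam (I `\` L))%E = 1%E.
  rewrite -lebesgue_unit setIC -measureU //; last first.
  - by apply/seteqP; split => // t [[_ ?] [_ ?]].
  - exact: measurableI.
  by rewrite setUIDK.
(* Off [L] one has q > e > 0, hence - q <= e; so [L'] contains this part as well as [J], and the two
   sublevel sets have total measure at least 1 + a. *)
have : (lam J + lam (I `\` L) <= lam (L' `&` I))%E.
  rewrite -measureU //; last first.
    by apply/seteqP; split => // t [/JL [Lt _] [_ ?]].
  apply: le_measure; rewrite ?inE; [exact: measurableU|exact: measurableI|].
  move=> t [Jt|[It Lt]].
    split; first by have [] := JL t Jt.
    by move: Jt; rewrite /J /= !in_itv /= => /andP[-> /le_trans ->].
  split => //; move/negP: Lt; rewrite /L /L' /= -ltNge => h.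
  by lra.
move=> h; apply: (lt_le_trans _ (leeD2l _ h)).
rewrite addeCA split1 lamJ -EFinD lte_fin; lra.
Unshelve. all: by end_near.
Qed.

End UnitInterval.

Section MomentMeasure.
Variables (R : realType) (d : nat).
Notation lam := (@lebesgue_measure R).
Notation I := (`[0, 1]%classic : set R).

(** Exponents start at 1, so the curve starts at 0 and its products with vectors are polynomials
    without constant term. *)
Definition moment (t : R) : 'rV[R]_d := \row_i t ^+ i.+1.

Lemma dotp_moment u t : dotp u (moment t) = ('X * rVpoly u).[t].
Proof.
rewrite hornerM hornerX /dotp (@horner_coef_wide _ d); last exact: size_poly.
rewrite mulr_sumr; apply: eq_bigr => i _.
by rewrite coef_rVpoly_ord mxE exprS mulrCA.
Qed.

(** The parameters are roots of a polynomial whose coefficients of positive degree are the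
    coordinates of [u]. *)
Lemma moment_hyperplane_finite u (a : R) : u != 0 ->
  finite_set [set t | dotp u (moment t) = a].
Proof.
move=> u0; have : 'X * rVpoly u - a%:P != 0.
  apply: contra_neq u0 => h; apply/rowP => i; rewrite -coef_rVpoly_ord mxE.
  have := congr1 (fun p : {poly R} => p`_i.+1) h.
  by rewrite coefB coefXM coefC coef0 /= subr0.
move/finite_roots; apply: sub_finite_set => t /=.
by rewrite dotp_moment /root hornerD hornerN hornerC => ->; rewrite subrr.
Qed.

Lemma moment_measurable (p : 'rV[R]_d) (s : R) :
  measurable_fun setT ((fun t => p + s *: moment t) : R -> borelRd R d).
Proof.
have := @measurability _ _ R (borelRd R d) setT (fun t => p + s *: moment t)
  (@open 'rV[R]_d) erefl; apply => _ [A Ao <-].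
rewrite setTI; apply: measurable_realfun.open_measurable.
apply: open_comp => // t _.
apply: row_continuous => i {}t.
rewrite (_ : (fun t => _) = horner ((p ord0 i)%:P + s *: 'X^(i.+1))); last first.
  by apply/funext => x; rewrite !mxE hornerD hornerC hornerZ hornerXn.
exact: continuous_horner.
Qed.

Lemma moment_measure_exists (p : 'rV[R]_d) :
  exists mu : {measure set (borelRd R d) -> \bar R}, forall A, mu A =
    (lam ([set t | A (p + moment t)%R] `&` I)
     + lam ([set t | A (p - moment t)%R] `&` I))%E.
Proof.
have mI : measurable I by exact: measurable_itv.
have push s : exists nu : {measure set (borelRd R d) -> \bar R},
    forall A, nu A = lam ([set t | A (p + s *: moment t)%R] `&` I).
  have mf := moment_measurable p s.
  pose f (t : R) : borelRd R d := p + s *: moment t.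
  by unshelve refine (ex_intro _
    (pushforward (mrestr lam mI) f : {measure set _ -> \bar R}) _).
have [nu1 nu1E] := push 1; have [nu2 nu2E] := push (-1).
exists (measure_add nu1 nu2) => A.
transitivity (nu1 A + nu2 A)%E; first exact: measure_addE.
rewrite nu1E nu2E.
congr (lam (_ `&` _) + lam (_ `&` _))%E; apply/funext => t /=.
  by rewrite scale1r.
by rewrite scaleN1r.
Qed.

(** The total mass is 2. If [p] were strictly on one side of the hyperplane, at distance e in terms
    of [dotp u], that side would have mass above 1 by [lebesgue_sublevel_gt]. *)
Lemma moment_measure (p : 'rV[R]_d) :
  exists mu : {measure set (borelRd R d) -> \bar R}, admissible mu /\
    forall u c, bisects u c mu -> dotp u p = c.
Proof.
have [mu muE] := moment_measure_exists p; exists mu; split.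
  split=> [|u c u0].
    by rewrite muE !setTI lebesgue_unit -EFinD lte_fin addr_gt0 // ltry.
  have null (A : set R) : finite_set A -> lam (A `&` I) = 0%E.
    move=> Af; apply: countable_lebesgue_measure0; apply: finite_set_countable.
    exact: sub_finite_set (@subIsetl _ A I) Af.
  rewrite muE !null ?adde0 //; apply: sub_finite_set.
  - move=> t; rewrite /hyperplane /= dotpDr dotpNr => h.
    apply: (_ : [set t | dotp u (moment t) = dotp u p - c] t).
    by rewrite /= -h; ring.
  - exact: moment_hyperplane_finite.
  - move=> t; rewrite /hyperplane /= dotpDr => h.
    apply: (_ : [set t | dotp u (moment t) = c - dotp u p] t).
    by rewrite /= -h; ring.
  - exact: moment_hyperplane_finite.
move=> u c; rewrite /bisects !muE !setTI !lebesgue_unit.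
pose q t := dotp u (moment t).
have qc : continuous q.
  have -> : q = horner ('X * rVpoly u) by apply/funext => t; exact: dotp_moment.
  exact: continuous_horner.
have q0 : q 0 = 0 by rewrite /q dotp_moment hornerM hornerX mul0r.
have -> : ((2^-1 : R)%:E * (1 + 1) = 1 :> \bar R)%E.
  by rewrite -EFinD -EFinM; congr EFin; lra.
have [cp|cp|//] := ltgtP (dotp u p) c => -[lo up].
  have e0 : 0 < c - dotp u p by rewrite subr_gt0.
  suff : (1 < 1 :> \bar R)%E by rewrite ltxx.
  rewrite -[ltRHS]lo; have := lebesgue_sublevel_gt qc q0 e0.
  congr (_ < lam (_ `&` _) + lam (_ `&` _))%E; apply/funext => t /=;
    by rewrite /lower_halfspace /= dotpDr ?dotpNr lerBrDl.
have e0 : 0 < dotp u p - c by rewrite subr_gt0.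
suff : (1 < 1 :> \bar R)%E by rewrite ltxx.
(* For the upper half-space the arc p + gamma gives the condition - q <= e, so the summands come in
   the other order. *)
rewrite -[ltRHS]up; have := lebesgue_sublevel_gt qc q0 e0; rewrite addeC.
congr (_ < lam (_ `&` _) + lam (_ `&` _))%E; apply/funext => t /=;
  rewrite /upper_halfspace /= dotpDr ?dotpNr -/(q t); apply/propext; split; lra.
Qed.

End MomentMeasure.

(** * Lower bound on the dimension *)

Lemma dotp_eq0 (R : realType) (d : nat) (u : 'rV[R]_d) :
  (dotp u u == 0) = (u == 0).
Proof.
apply/eqP/eqP => [|->]; last exact: dot0p.
move/psumr_eq0P => h; apply/rowP => i; rewrite mxE.
have /eqP := h (fun i _ => sqr_ge0 (u ord0 i)) i isT.
by rewrite mulf_eq0 orbb => /eqP.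
Qed.

(** The Gram matrix is diagonal with nonzero entries, hence invertible. *)
Lemma row_free_orthogonal (R : realType) (d k : nat) (u : 'I_k -> 'rV[R]_d) :
  (forall i, u i != 0) -> (forall i i', i != i' -> dotp (u i) (u i') = 0) ->
  row_free (\matrix_i u i).
Proof.
move=> u0 uu; set A := \matrix_i u i.
rewrite /row_free eqn_leq rank_leq_row.
have AA : A *m A^T = diag_mx (\row_i dotp (u i) (u i)).
  apply/matrixP => i j; rewrite !mxE.
  transitivity (dotp (u i) (u j)); first by apply: eq_bigr => l _; rewrite !mxE.
  by have [->|/uu ->] := eqVneq i j; rewrite ?mulr1n ?mulr0n.
apply: leq_trans (mxrankM_maxl A A^T); rewrite AA mxrank_unit //.
rewrite unitmxE det_diag unitfE; apply/prodf_neq0 => i _.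
by rewrite mxE dotp_eq0.
Qed.

Lemma orthogonal_bisection_dim (R : realType) (d m k : nat) :
  (0 < m)%N -> (0 < k)%N -> orthogonal_bisection R d m k -> (m + k <= d.+1)%N.
Proof.
move=> m0 k0 bis.
(* The centre [p 0] is 0, which forces all offsets to vanish; [p l.+1] is the unit vector of
   coordinate l, which then forces that coordinate of every normal to vanish. *)
pose p (j : 'I_m) : 'rV[R]_d := \row_i (i.+1 == j)%:R.
have [mu hmu] := choice (fun j => moment_measure (p j)).
have [u [c [u0 uu uc]]] := bis mu (fun j => (hmu j).1).
have up i j : dotp (u i) (p j) = c i by apply: (hmu j).2; exact: uc.
have c0 i : c i = 0.
  rewrite -(up i (Ordinal m0)) /dotp big1 // => l _.
  by rewrite mxE /= mulr0.
have ul i (l : 'I_d) : (l.+1 < m)%N -> u i ord0 l = 0.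
  move=> lm; rewrite -(c0 i) -(up i (Ordinal lm)) /dotp (bigD1 l) //=.
  rewrite mxE /= eqxx mulr1 big1 ?addr0 // => l' ll'.
  by rewrite mxE /= eqSS -[(_ == _)%N]/(l' == l) (negbTE ll') mulr0.
have := row_free_orthogonal u0 uu; set A := \matrix_i u i => /eqP rA.
(* The minimum covers d < m - 1, where all coordinates would vanish; the bound k <= d - r then
   contradicts k > 0. *)
pose r := minn m.-1 d.
have rd : (r <= d)%N by exact: geq_minr.
(* The normals are fixed by the projection killing the first r coordinates, whose rank is d - r. *)
have Ar : A *m copid_mx r = A.
  rewrite /copid_mx mulmxBr mulmx1 (_ : A *m pid_mx r = 0) ?subr0 //.
  apply/matrixP => i j; rewrite !mxE big1 // => l _; rewrite !mxE.
  case: eqP => [lj|]; last by rewrite mulr0.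
  case: ltnP => [lr|]; last by rewrite mulr0.
  rewrite ul ?mul0r // -ltn_predRL.
  by apply: leq_trans lr _; rewrite geq_minl.
have : (k <= d - r)%N.
  by rewrite -rA -Ar -(rank_copid_mx R rd) mxrankM_maxr.
rewrite /r; lia.
Qed.

Theorem proposition4p1 (R : realType) (m k : nat) (hm : (1 <= m)%N)
    (hk : (1 <= k)%N) :
  is_Delta_star1 R m k (m + k - 1)%N.
Proof.
split; first by apply: orthogonal_bisection_exists => //; lia.
move=> d' /(orthogonal_bisection_dim hm hk); lia.
Qed.
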